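(* If $G$ is a right-angled Artin group whose defining graph is a cycle of odd length, then $G$ does not act properly (with or without swapping factors) on any product of two trees (whether locally finite or not).
   Context: The right-angled Artin group (RAAG) defined by a finite simplicial graph has one generator for each vertex, with defining relations that two generators commute whenever the corresponding vertices are joined by an edge. Trees are simplicial trees. A group acts on a product of trees $P=T_1\times T_2$ by automorphisms of the natural cube complex structure; it preserves factors if the action is given by a homomorphism to $\mathrm{Aut}(T_1)\times\mathrm{Aut}(T_2)$, and otherwise it may swap the two factors. The action is proper if the stabiliser of every vertex of $P$ is finite. *)

(* Defs.v *)
From HB Require Import structures.
From mathcomp Require Import all_boot.
From mathcomp Require Import boolp classical_sets cardinality.

Set Implicit Arguments.
Unset Strict Implicit.
Unset Printing Implicit Defensive.

Local Open Scope quotient_scope.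

(* Words in S and formal inverses: (s, true) stands for s and (s, false) for
   the formal inverse of s. *)
Definition word (S : Type) := seq (S * bool).

Definition winv (S : Type) (w : word S) : word S :=
  rev [seq (a.1, ~~ a.2) | a <- w].

(* The congruence on words generated by free cancellation and by the relations
   l = r with R l r. *)
Inductive word_eqv (S : Type) (R : word S -> word S -> Prop) :
    word S -> word S -> Prop :=
| word_eqv_refl w : word_eqv R w w
| word_eqv_sym w1 w2 : word_eqv R w1 w2 -> word_eqv R w2 w1
| word_eqv_trans w1 w2 w3 :
    word_eqv R w1 w2 -> word_eqv R w2 w3 -> word_eqv R w1 w3
| word_eqv_cancel u v s b :
    word_eqv R (u ++ [:: (s, b); (s, ~~ b)] ++ v) (u ++ v)
| word_eqv_rel u v l r :
    R l r -> word_eqv R (u ++ l ++ v) (u ++ r ++ v).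

Section PresentedGroup.
Variables (S : choiceType) (R : word S -> word S -> Prop).

Definition word_eqvb : rel (word S) := fun w1 w2 => `[< word_eqv R w1 w2 >].

Fact word_eqvb_refl : reflexive word_eqvb.
Proof. by move=> w; apply/asboolP/word_eqv_refl. Qed.

Fact word_eqvb_sym : symmetric word_eqvb.
Proof. by move=> w1 w2; apply/asboolP/asboolP => /word_eqv_sym. Qed.

Fact word_eqvb_trans : transitive word_eqvb.
Proof.
move=> w2 w1 w3 /asboolP h1 /asboolP h2.
by apply/asboolP; exact: word_eqv_trans h1 h2.
Qed.

Canonical word_equiv_rel :=
  EquivRel word_eqvb word_eqvb_refl word_eqvb_sym word_eqvb_trans.

(* The group < S | l = r for all l, r with R l r >. *)
Definition presented := {eq_quot word_equiv_rel}.

HB.instance Definition _ := Choice.on presented.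
HB.instance Definition _ := EqQuotient.on presented.

Definition presented_of_word (w : word S) : presented := \pi_presented w.

Definition presented_gen (s : S) : presented := presented_of_word [:: (s, true)].

Definition presented_one : presented := presented_of_word [::].

Definition presented_mul (x y : presented) : presented :=
  presented_of_word (repr x ++ repr y).

Definition presented_inv (x : presented) : presented :=
  presented_of_word (winv (repr x)).

Lemma presented_of_wordP w1 w2 :
  presented_of_word w1 = presented_of_word w2 <-> word_eqv R w1 w2.
Proof.
split; first by move=> /eqquotP /asboolP.
by move=> h; apply/eqquotP/asboolP.
Qed.

Lemma presented_of_word_repr x : presented_of_word (repr x) = x.
Proof. exact: reprK. Qed.

Lemma word_eqv_repr w : word_eqv R (repr (presented_of_word w)) w.
Proof. by apply/presented_of_wordP; rewrite presented_of_word_repr. Qed.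

Lemma word_eqv_cat2l u w1 w2 :
  word_eqv R w1 w2 -> word_eqv R (u ++ w1) (u ++ w2).
Proof.
elim=> [w|? ? _ /word_eqv_sym //|? ? ? _ h1 _ h2|u' v s b|u' v l r Rlr].
- exact: word_eqv_refl.
- exact: word_eqv_trans h1 h2.
- by rewrite !(catA u); exact: word_eqv_cancel.
- by rewrite !(catA u); exact: word_eqv_rel.
Qed.

Lemma word_eqv_cat2r u w1 w2 :
  word_eqv R w1 w2 -> word_eqv R (w1 ++ u) (w2 ++ u).
Proof.
elim=> [w|? ? _ /word_eqv_sym //|? ? ? _ h1 _ h2|u' v s b|u' v l r Rlr].
- exact: word_eqv_refl.
- exact: word_eqv_trans h1 h2.
- by rewrite -!catA; exact: word_eqv_cancel.
- by rewrite -!catA; exact: word_eqv_rel.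
Qed.

Lemma presented_of_word_cat w1 w2 :
  presented_mul (presented_of_word w1) (presented_of_word w2) =
  presented_of_word (w1 ++ w2).
Proof.
apply/presented_of_wordP.
apply: (word_eqv_trans (word_eqv_cat2r _ (word_eqv_repr w1))).
exact: word_eqv_cat2l (word_eqv_repr w2).
Qed.

Lemma winvK : involutive (@winv S).
Proof.
move=> w; rewrite /winv map_rev revK -map_comp -[RHS]map_id.
by apply: eq_map => -[s b] /=; rewrite negbK.
Qed.

Lemma word_eqv_winvl w : word_eqv R (winv w ++ w) [::].
Proof.
elim: w => [|[s b] w IHw]; first exact: word_eqv_refl.
rewrite /winv /= rev_cons cat_rcons.
have := word_eqv_cancel R (winv w) w s (~~ b); rewrite negbK => h.
exact: word_eqv_trans h IHw.
Qed.

Fact presented_mulA : associative presented_mul.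
Proof.
move=> x y z; rewrite -[x]presented_of_word_repr -[y]presented_of_word_repr.
by rewrite -[z]presented_of_word_repr !presented_of_word_cat catA.
Qed.

Fact presented_1mul : left_id presented_one presented_mul.
Proof.
by move=> x; rewrite -[x]presented_of_word_repr presented_of_word_cat.
Qed.

Fact presented_mul1 : right_id presented_one presented_mul.
Proof.
by move=> x; rewrite -[x]presented_of_word_repr presented_of_word_cat cats0.
Qed.

Fact presented_Vmul : left_inverse presented_one presented_inv presented_mul.
Proof.
move=> x; rewrite -{2}[x]presented_of_word_repr presented_of_word_cat.
exact/presented_of_wordP/word_eqv_winvl.
Qed.

Fact presented_mulV : right_inverse presented_one presented_inv presented_mul.
Proof.
move=> x; rewrite -{1}[x]presented_of_word_repr presented_of_word_cat.
apply/presented_of_wordP; rewrite -{1}[repr x]winvK.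
exact: word_eqv_winvl.
Qed.

HB.instance Definition _ := isGroup.Build presented presented_mulA
  presented_1mul presented_mul1 presented_Vmul presented_mulV.

End PresentedGroup.

Record sgraph := SGraph {
  vertex :> finType;
  sadj : rel vertex;
  sadj_sym : symmetric sadj;
  sadj_irr : irreflexive sadj }.

(* Gamma is isomorphic to the cycle 0 - 1 - ... - (n-1) - 0, where simplicial
   cycles have length at least 3; ordS is the successor modulo n. *)
Definition is_cycle_graph (Gamma : sgraph) (n : nat) : Prop :=
  2 < n /\
  exists2 f : 'I_n -> Gamma, bijective f &
    forall i j, sadj (f i) (f j) = (j == ordS i) || (i == ordS j).

Definition raag_rel (Gamma : sgraph) (l r : word Gamma) : Prop :=
  exists x y : Gamma, [/\ sadj x y,
    l = [:: (x, true); (y, true)] & r = [:: (y, true); (x, true)]].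

Definition raag (Gamma : sgraph) : groupType := presented (@raag_rel Gamma).

(* Classically every type is an eqType and every relation is boolean, so there
   is no restriction on the cardinality or local finiteness of the tree. *)
Record tree := Tree {
  node :> eqType;
  tadj : rel node;
  tadj_sym : symmetric tadj;
  tadj_irr : irreflexive tadj;
  tree_inhabited : inhabited node;
  tree_connected : forall x y, exists2 p, path tadj x p & last x p = y;
  tree_acyclic : forall c : seq node, 2 < size c -> ~ ucycle tadj c }.

Local Open Scope classical_set_scope.

(* Cells are represented by their sets of vertices. *)
Definition tree_cell (T : tree) (A : set T) : Prop :=
  (exists x, A = [set x]) \/ (exists x y, tadj x y /\ A = [set x; y]).

Definition product_cube (T1 T2 : tree) (C : set (T1 * T2)) : Prop :=
  exists A B, [/\ tree_cell A, tree_cell B & C = A `*` B].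

(* An automorphism of the cube complex T1 x T2, given by its action on
   vertices. It may exchange the two tree directions. *)
Definition cube_automorphism (T1 T2 : tree) (f : T1 * T2 -> T1 * T2) : Prop :=
  bijective f /\ forall C, product_cube C <-> product_cube (f @` C).

Record cube_action (G : groupType) (T1 T2 : tree) := CubeAction {
  cact :> G -> T1 * T2 -> T1 * T2;
  cact1 : forall v, cact 1%g v = v;
  cactM : forall g h v, cact (g * h)%g v = cact g (cact h v);
  cact_aut : forall g, cube_automorphism (cact g) }.

Definition proper_action (G : groupType) (T1 T2 : tree)
    (rho : cube_action G T1 T2) : Prop :=
  forall v, finite_set [set g | rho g v = v].

(* Main.v *)
From HB Require Import structures.
Require Import Defs.
From mathcomp Require Import all_boot all_algebra.
From mathcomp Require Import boolp classical_sets cardinality zify ring.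

(* Squares of cube automorphisms preserve the two factors, so precomposing the
   action with the endomorphism v |-> v^2 of the Artin group yields an action on
   each tree. Under a proper action an element with a fixed vertex in both trees
   is mapped by this endomorphism to a torsion element, which the
   abelianisation and maps to the Heisenberg group forbid for the
   elements in question.

   If neither of two adjacent generators x, y had an axis in one of the trees,
   then x^2 and y^2 would have a common fixed vertex there, and some nontrivial
   x^(2p) y^(2q) would also fix a vertex of the other tree. Hence the generators
   without an axis in a given tree form an independent set. An odd cycle is not
   covered by two independent sets, so some generator u has an axis in both
   trees. A neighbour of u translates the end of each axis of u. The commutator
   of the two neighbours therefore fixes a vertex in both trees; if the
   neighbours commute (the triangle), some nontrivial u^p x^q y^r does, because
   three vectors of Z^2 are linearly dependent. *)

Set Implicit Arguments.
Unset Strict Implicit.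
Unset Printing Implicit Defensive.

Import GRing.Theory.
Local Open Scope int_scope.
Local Open Scope nat_scope.

(** * Walks in trees *)

Lemma ex_min_nat (P : nat -> Prop) :
  (exists m, P m) -> exists2 m, P m & forall k, P k -> m <= k.
Proof.
move=> [m Pm]; have exP : exists m, `[< P m >] by exists m; apply/asboolP.
case: (ex_minnP exP) => k /asboolP Pk kmin; exists k => // j Pj.
exact/kmin/asboolP.
Qed.

Lemma mkseq_consS (A : Type) (w : nat -> A) n :
  mkseq w n.+1 = w 0 :: mkseq (fun i => w i.+1) n.
Proof. by rewrite /mkseq /= (iotaDl 1 0) -map_comp. Qed.

Section TreeWalks.
Variable T : tree.
Implicit Types (x y : T) (g h w : nat -> T).

(** Walks are total functions on [nat] of which only the values up to [n] count, so that finite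
    walks and rays share one type. *)
Definition walk w n := forall i, i < n -> tadj (w i) (w i.+1).

Definition rwalk w n := walk w n /\ forall i, i.+1 < n -> w i != w i.+2.

Lemma walk_trunc w m n : m <= n -> walk w n -> walk w m.
Proof. by move=> le_mn hw i hi; apply: hw; lia. Qed.

Lemma rwalk_sub w a n N :
  a + n <= N -> rwalk w N -> rwalk (fun i => w (a + i)) n.
Proof.
move=> hN [hw rw]; split=> i hi; first by rewrite addnS; apply: hw; lia.
by rewrite !addnS; apply: rw; lia.
Qed.

Lemma rwalk_rev w n : rwalk w n -> rwalk (fun i => w (n - i)) n.
Proof.
move=> [hw rw]; split=> i hi.
  by rewrite tadj_sym; have -> : n - i = (n - i.+1).+1 by [lia]; apply: hw; lia.
by rewrite eq_sym; have -> : n - i = (n - i.+2).+2 by [lia]; apply: rw; lia.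
Qed.

Definition wcat g n h := fun i => if i < n then g i else h (i - n).

Lemma wcatl g n h i : g n = h 0 -> i <= n -> wcat g n h i = g i.
Proof.
rewrite /wcat => gh; case: ltnP => // h1 h2.
by have -> : i = n by [lia]; rewrite subnn.
Qed.

Lemma wcatr g n h i : wcat g n h (n + i) = h i.
Proof. by rewrite /wcat ltnNge leq_addr /= addKn. Qed.

Lemma walk_cat g n h m :
  walk g n -> walk h m -> g n = h 0 -> walk (wcat g n h) (n + m).
Proof.
move=> hg hh gh i hi; case: (ltnP i n) => hin.
  by rewrite !wcatl //; [apply: hg | lia].
have -> : i = n + (i - n) by lia.
by rewrite -addnS !wcatr; apply: hh; lia.
Qed.

Lemma rwalk_cat g n h m :
  rwalk g n -> rwalk h m -> g n = h 0 ->
  (0 < n -> 0 < m -> g n.-1 != h 1) -> rwalk (wcat g n h) (n + m).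
Proof.
move=> [hg rg] [hh rh] gh gh1; split; first exact: walk_cat.
move=> i hi; case: (ltnP i.+1 n) => hin.
  by rewrite !wcatl //; [apply: rg | lia].
case: (ltnP i n) => hin'.
  have -> : i.+2 = n + 1 by lia.
  have -> : i = n.-1 by lia.
  by rewrite wcatr wcatl //; [apply: gh1; lia | lia].
have -> : i = n + (i - n) by lia.
by rewrite -!addnS !wcatr; apply: rh; lia.
Qed.

(** By induction the walk without its first vertex is injective, so a repetition has the form
    [w 0 = w j.+1]. Then [w 0, ..., w j] is a cycle; it has at least three vertices because loops
    and backtracking are excluded. *)
Lemma rwalk_uniq w n : rwalk w n -> uniq (mkseq w n.+1).
Proof.
suff hyp k : forall w, rwalk w k -> uniq (mkseq w k.+1) by exact: hyp.
elim: k => [|k IH] {}w [hw rw] //.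
rewrite mkseq_consS cons_uniq IH ?andbT;
  last by have := rwalk_sub (a := 1) (leqnn _) (conj hw rw).
apply/negP => /mapP [j]; rewrite mem_iota add0n => /andP [_ hj] wj.
have j2 : 1 < j.
  case: j hj wj => [|[|//]] hj wj.
    by have := hw 0 isT; rewrite wj tadj_irr.
  by have := rw 0 hj; rewrite wj eqxx.
apply: (@tree_acyclic T (mkseq w j.+1)); first by rewrite size_mkseq.
rewrite /ucycle; apply/andP; split; last first.
  have := IH _ (rwalk_sub (a := 1) (leqnn _) (conj hw rw)).
  have -> : k.+1 = j + (k.+1 - j) by lia.
  rewrite /mkseq iotaD map_cat cat_uniq => /andP[u1 /andP[/hasPn nin _]].
  rewrite -/(mkseq w j.+1) mkseq_consS cons_uniq {2}/mkseq u1 andbT.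
  rewrite wj; apply: (nin (w j.+1)); apply/mapP; exists j => //.
  by rewrite mem_iota; lia.
rewrite mkseq_consS /= rcons_path.
have hpath : forall i, i <= j ->
    path (@tadj T) (w 0) (mkseq (fun i => w i.+1) i) /\
    last (w 0) (mkseq (fun i => w i.+1) i) = w i.
  elim=> [|i IHi] // hi; have [p1 l1] := IHi (ltnW hi).
  rewrite mkseqS last_rcons rcons_path p1 l1 /=; split=> //.
  by apply: hw; lia.
have [-> ->] := hpath j (leqnn _).
by rewrite /= wj; apply: hw; lia.
Qed.

Lemma rwalk_inj w n i j :
  rwalk w n -> i <= n -> j <= n -> w i = w j -> i = j.
Proof.
move=> hw hi hj eqw; apply/eqP.
rewrite -(nth_uniq (w 0) _ _ (rwalk_uniq hw)) ?size_mkseq ?ltnS //.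
by rewrite !nth_mkseq ?ltnS // eqw.
Qed.

(** Going back along [g] to the branch point [t] and then out along [h] is again a reduced walk,
    hence injective, so its two ends differ. *)
Lemma rwalk_fork g n h m t :
  rwalk g n -> rwalk h m -> t < n -> t < m -> g t = h t -> g t.+1 != h t.+1 ->
  g n != h m.
Proof.
move=> hg hh tn tm ght ghS; apply/eqP => gh.
have r1 := rwalk_rev (rwalk_sub (a := t) (n := n - t) (N := n) ltac:(lia) hg).
have r2 := rwalk_sub (a := t) (n := m - t) (N := m) ltac:(lia) hh.
have := rwalk_cat r1 r2; rewrite subnn !addn0 => /(_ ght) [|hw rw].
  move=> _ _; have -> : t + (n - t - (n - t).-1) = t.+1 by lia.
  by rewrite addn1.
have := rwalk_inj (conj hw rw) (leq0n _) (leqnn _).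
rewrite wcatr wcatl ?subnn ?addn0 // subn0.
have -> : t + (n - t) = n by lia.
by have -> : t + (m - t) = m by [lia]; move=> /(_ gh); lia.
Qed.

Lemma rwalk_unique g n h m :
  rwalk g n -> rwalk h m -> g 0 = h 0 -> g n = h m ->
  n = m /\ forall i, i <= n -> g i = h i.
Proof.
move=> hg hh gh0 ghn.
have agree i : i <= n -> i <= m -> g i = h i.
  elim: i => [|i IH] hn hm //; have {}IH := IH (ltnW hn) (ltnW hm).
  case: (eqVneq (g i.+1) (h i.+1)) => // ghS.
  by have := rwalk_fork hg hh hn hm IH ghS; rewrite ghn eqxx.
have nm : n = m.
  case: (ltngtP n m) => // hlt.
    by move: (agree n (leqnn _) (ltnW hlt)); rewrite ghn =>
      /(rwalk_inj hh (leqnn _) (ltnW hlt)) e; lia.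
  by move: (agree m (ltnW hlt) (leqnn _)); rewrite -ghn =>
      /(rwalk_inj hg (ltnW hlt) (leqnn _)) e; lia.
by split=> // i hi; apply: agree; rewrite -?nm.
Qed.

Lemma walk_exists x y : exists w n, [/\ walk w n, w 0 = x & w n = y].
Proof.
have [p hp lp] := tree_connected x y.
exists (nth x (x :: p)), (size p); split=> //; last first.
  by rewrite -lp (last_nth x).
by move=> i hi; apply: (pathP x hp).
Qed.

(** A backtrack could be cut out, leaving a shorter walk with the same ends. *)
Lemma walk_min_rwalk w m :
  walk w m -> (forall g n, walk g n -> g 0 = w 0 -> g n = w m -> m <= n) ->
  rwalk w m.
Proof.
move=> hw wmin; split=> // i hi; apply/eqP => wi.
have h1 : walk w i by apply: walk_trunc hw; lia.
have h2 : walk (fun k => w (i.+2 + k)) (m - i.+2).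
  by move=> k hk; rewrite addnS; apply: hw; lia.
have := wmin _ _ (walk_cat h1 h2 _); rewrite addn0 wcatr wcatl // ?addn0 //.
have -> : i.+2 + (m - i.+2) = m by lia.
by move=> /(_ wi erefl erefl); lia.
Qed.

Lemma nearest_walk (A B : T -> Prop) :
  (exists x, A x) -> (exists y, B y) ->
  exists w m, [/\ rwalk w m, A (w 0), B (w m) &
    forall g n, walk g n -> A (g 0) -> B (g n) -> m <= n].
Proof.
move=> [x Ax] [y By].
pose P m := exists w, [/\ walk w m, A (w 0) & B (w m)].
have [|m [w [hw Aw Bw]] mmin] := @ex_min_nat P.
  have [w [n [hw w0 wn]]] := walk_exists x y.
  by exists n, w; rewrite w0 wn.
exists w, m; split=> // [|g n hg Ag Bg]; last by apply: mmin; exists g.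
apply: walk_min_rwalk => // g n hg g0 gn.
by apply: mmin; exists g; rewrite g0 gn.
Qed.

Definition ray w := forall n, rwalk w n.

End TreeWalks.

(** * Actions on trees *)

Definition zexpg (G : groupType) (g : G) (z : int) : G :=
  match z with Posz n => (g ^+ n)%g | Negz n => (g ^- n.+1)%g end.

Record tree_action (G : groupType) (T : tree) := TreeAction {
  tact :> G -> T -> T;
  tact1 : forall x, tact 1%g x = x;
  tactM : forall g h x, tact (g * h)%g x = tact g (tact h x);
  tact_adj : forall g x y, tadj x y -> tadj (tact g x) (tact g y) }.

Section TreeActions.
Variables (G : groupType) (T : tree) (a : tree_action G T).
Implicit Types (g h : G) (x y : T) (f w : nat -> T).

Lemma tactK g : cancel (a g) (a g^-1%g).
Proof. by move=> x; rewrite -tactM mulVg tact1. Qed.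

Lemma tact_inj g : injective (a g).
Proof. exact: can_inj (tactK g). Qed.

Lemma tact_commute g h x : commute g h -> a g (a h x) = a h (a g x).
Proof. by move=> gh; rewrite -!tactM gh. Qed.

Lemma walk_act g w n : walk w n -> walk (fun i => a g (w i)) n.
Proof. by move=> hw i hi; apply/tact_adj/hw. Qed.

Lemma rwalk_act g w n : rwalk w n -> rwalk (fun i => a g (w i)) n.
Proof.
move=> [hw rw]; split=> [|i hi]; first exact: walk_act.
by rewrite (inj_eq (@tact_inj g)) rw.
Qed.

Lemma ray_act g f : ray f -> ray (fun i => a g (f i)).
Proof. by move=> hf n; apply: rwalk_act. Qed.

Definition elliptic g := exists x, a g x = x.

Lemma fixV g x : a g x = x -> a g^-1%g x = x.
Proof. by move=> gx; rewrite -{1}gx tactK. Qed.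

Lemma fix_zexpg g z x : a g x = x -> a (zexpg g z) x = x.
Proof.
move=> gx; have gn n : a (g ^+ n)%g x = x.
  by elim: n => [|n IH]; rewrite ?expg0 ?tact1 // expgS tactM IH.
by case: z => n /=; rewrite ?fixV.
Qed.

(** Let [w] be a shortest walk from the fixed set of [g] to that of [h]. Followed by the [h]-image
    of its reverse it stays reduced, since otherwise [h] would fix the last vertex but one. Both
    ends of this geodesic are fixed by [g], hence so is its midpoint [w m], which [h] fixes too. *)
Lemma elliptic_common_fixpoint g h :
  commute g h -> elliptic g -> elliptic h -> exists x, a g x = x /\ a h x = x.
Proof.
move=> gh eg eh; have [w [m [hw gw hw' wmin]]] := nearest_walk eg eh.
have hwm : 0 < m -> w m.-1 != a h (w (m - 1)).
  move=> m0; apply/eqP; rewrite subn1 => /esym e.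
  have wt : walk w m.-1 by apply: walk_trunc hw.1; lia.
  by have := wmin _ _ wt gw e; lia.
have := rwalk_cat hw (rwalk_act h (rwalk_rev hw)); rewrite subn0 hw'.
move=> /(_ erefl (fun m0 _ => hwm m0)) hW.
set W := wcat _ _ _ in hW.
have W0 : W 0 = w 0 by rewrite /W wcatl ?subn0.
have Wm : W m = w m by rewrite /W wcatl ?subn0.
have WN : W (m + m) = a h (w 0) by rewrite /W wcatr subnn.
have [||_ /(_ m (leq_addr _ _))] := rwalk_unique hW (rwalk_act g hW).
- by rewrite W0 gw.
- by rewrite WN tact_commute // gw.
rewrite Wm => /esym gwm.
by exists (w m).
Qed.

(* Only one end of the usual axis is kept, so that [f] is a ray. *)
Definition has_axis g :=
  exists f l, [/\ ray f, 0 < l & forall k, a g (f k) = f (k + l)].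

(** A walk of minimal length [m] from a vertex to its [g]-image is taken as fundamental segment, and
    its translates form the axis. The square appears because [g] may invert an edge, in which case
    only [g * g] fixes a vertex. *)
Lemma elliptic_or_axis g : elliptic (g * g)%g \/ has_axis g.
Proof.
have [|nell] := EM (elliptic (g * g)%g); [by left | right].
have [|m [w [hw wm]] mmin] := @ex_min_nat (fun m =>
    exists w, walk w m /\ w m = a g (w 0)).
  have [x] := tree_inhabited T.
  have [w [n [hw w0 wn]]] := walk_exists x (a g x).
  by exists n, w; rewrite w0.
have m0 : 0 < m.
  case: m hw wm {mmin} => // _ w0; case: nell; exists (w 0).
  by rewrite tactM -w0.
have rw : rwalk w m.
  apply: walk_min_rwalk => // v n hv v0 vn.
  by apply: mmin; exists v; rewrite v0 vn.
pose f k := a (g ^+ (k %/ m))%g (w (k %% m)).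
have fE q i : i <= m -> f (q * m + i) = a (g ^+ q)%g (w i).
  rewrite leq_eqVlt /f => /orP[/eqP ->|im]; last first.
    by rewrite divnMDl // modnMDl divn_small // modn_small // addn0.
  by rewrite -mulSnr mulnK // modnMl expgSr tactM -wm.
have fk k : f k = f (k %/ m * m + k %% m) by rewrite -divn_eq.
have fk1 k : f k.+1 = f (k %/ m * m + (k %% m).+1) by rewrite addnS -divn_eq.
exists f, m; split=> // [n|k]; last first.
  by rewrite {2}/f divnDr // divnn m0 addn1 modnDr expgS tactM.
split=> k _; have im := ltn_pmod k m0.
  by rewrite fk1 fk !fE //; [apply/tact_adj/hw | apply: ltnW].
have fk2 : f k.+2 = f (k %/ m * m + (k %% m).+2) by rewrite !addnS -divn_eq.
rewrite fk fk2; case: (ltnP (k %% m).+1 m) => im1.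
  by rewrite !fE ?(ltnW im) //; rewrite (inj_eq (@tact_inj _)) rw.2.
have e : (k %% m) = m.-1 by lia.
have -> : k %/ m * m + (k %% m).+2 = (k %/ m).+1 * m + 1 by lia.
(* At a junction of two translates, backtracking means [w m.-1 = a g (w 1)]. If [m > 1], then [w 1]
   is displaced by only [m - 2]; if [m = 1], then [g] inverts the edge from [w 0] to [w 1]. *)
rewrite !fE ?(ltnW im) // expgSr tactM (inj_eq (@tact_inj _)) e.
apply/eqP => e1; case: (ltnP 1 m) => m1.
  have h : walk (fun i => w i.+1) (m - 2).
    by move=> i hi; apply: hw; lia.
  have := mmin (m - 2); have em : (m - 2).+1 = m.-1 by lia.
  have P : exists w, walk w (m - 2) /\ w (m - 2) = a g (w 0).
    by exists (fun i => w i.+1); rewrite em.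
  by move=> /(_ P); lia.
have m_1 : m = 1 by lia.
by case: nell; exists (w 0); rewrite tactM -wm m_1 -e1 m_1.
Qed.

(* Two rays translated by [g] have the same end: a shortest bridge of length
   [m] between them would make the two geodesics joining its translates have
   lengths [l] and [l + 2 m]. *)
Lemma axis_merge g f f' l :
  ray f -> ray f' -> 0 < l ->
  (forall k, a g (f k) = f (k + l)) -> (forall k, a g (f' k) = f' (k + l)) ->
  exists i j, forall k, f' (k + i) = f (k + j).
Proof.
move=> rf rf' l0 gf gf'.
have [||w [m [hw [i wi] [j wj] wmin]]] :=
    @nearest_walk T (fun x => exists i, x = f' i) (fun x => exists j, x = f j).
- by exists (f' 0), 0.
- by exists (f 0), 0.
have wmin' v n i' j' : walk v n -> v 0 = f' i' -> v n = f j' -> m <= n.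
  by move=> hv v0 vn; apply: (wmin v n hv); [exists i' | exists j'].
have [m0|m0] := posnP m.
  rewrite m0 in wj; exists i, j => k.
  (* The rays meet, so they agree at all later multiples of [l], and in between by uniqueness of
     geodesics. *)
  have eqn n : f' (i + n * l) = f (j + n * l).
    elim: n => [|n IH]; first by rewrite !addn0 -wi -wj.
    by rewrite mulSnr !addnA -gf -gf' IH.
  have r n := rwalk_sub (leqnn (i + n)) (rf' (i + n)).
  have r' n := rwalk_sub (leqnn (j + n)) (rf (j + n)).
  have [||_ /(_ k)] := rwalk_unique (r (k * l)) (r' (k * l)).
  - by rewrite !addn0 -wi -wj.
  - exact: eqn.
  by rewrite leq_pmulr // => /(_ isT); rewrite !(addnC k).
(* The second geodesic from [f' i] to [f' (i + l)] runs along the bridge, then along [f] for [l]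
   steps, then back along the translated bridge. A backtrack at either turn would give a shorter
   bridge. *)
have r1 := rwalk_sub (leqnn (j + l)) (rf (j + l)).
have := rwalk_cat hw r1; rewrite addn0 wj => /(_ erefl) hW.
have {}hW : rwalk (wcat w m (fun k => f (j + k))) (m + l).
  apply: hW => _ _; apply/eqP => e.
  have wt : walk w m.-1 by apply: walk_trunc hw.1; lia.
  by have := wmin' _ _ _ _ wt wi e; lia.
have := rwalk_cat hW (rwalk_act g (rwalk_rev hw)).
rewrite wcatr subn0 wj gf => /(_ erefl) hW2.
have r1' := rwalk_sub (leqnn (i + l)) (rf' (i + l)).
case: (rwalk_unique (hW2 _) r1').
- move=> _ _; have -> : (m + l).-1 = m + l.-1 by lia.
  rewrite wcatr; apply/eqP => /esym e.
  have wt : walk (fun i => a g (w i)) (m - 1).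
    by apply/walk_act; apply: walk_trunc hw.1; lia.
  have := wmin' _ _ (i + l) _ wt _ e; rewrite wi gf' => /(_ erefl); lia.
- by rewrite wcatl ?wcatr ?subn0 ?wj ?gf // wcatl ?addn0 ?wj.
- by rewrite wcatr subnn wi gf'.
by move=> e; lia.
Qed.

(* [shift f g s]: [g] translates the ray [f] by [s] near its end. *)
Definition shift f g (s : int) :=
  exists p q : nat,
    q%:Z = (p%:Z + s)%R /\ forall k, a g (f (k + p)) = f (k + q).

Lemma axis_shift f g l : (forall k, a g (f k) = f (k + l)) -> shift f g l.
Proof. by move=> gf; exists 0, l; split=> // k; rewrite addn0. Qed.

Lemma shift1 f : shift f 1%g 0%R.
Proof. by exists 0, 0; split=> // k; rewrite tact1. Qed.

Lemma shiftM f g h s t :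
  shift f g s -> shift f h t -> shift f (g * h)%g (s + t)%R.
Proof.
move=> [p [q [e hg]]] [p' [q' [e' hh]]]; exists (p + p'), (q + q').
split=> [|k]; first by lia.
rewrite tactM addnA hh; have -> : k + p + q' = (k + q') + p by lia.
by rewrite hg; congr f; lia.
Qed.

Lemma shiftV f g s : shift f g s -> shift f g^-1%g (- s)%R.
Proof.
move=> [p [q [e hg]]]; exists q, p; split=> [|k]; first by lia.
by rewrite -hg tactK.
Qed.

Lemma shift_zexpg f g s z : shift f g s -> shift f (zexpg g z) (z * s)%R.
Proof.
move=> hg; have gn n : shift f (g ^+ n)%g (n%:Z * s)%R.
  elim: n => [|n IH]; first by rewrite expg0 mul0r; exact: shift1.
  rewrite expgS (_ : (n.+1%:Z * s)%R = (s + n%:Z * s)%R); last by lia.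
  exact: shiftM.
case: z => n /=; first exact: gn.
by rewrite NegzE mulNr; apply: shiftV.
Qed.

Lemma shift0_elliptic f g : shift f g 0%R -> elliptic g.
Proof.
move=> [p [q [e hg]]]; exists (f p); have -> : p = q by lia.
by have := hg 0; rewrite !add0n; have -> : p = q by lia.
Qed.

(** The ray [h f] is also translated by [g] by [l], so it merges with [f]; the offset at which they
    merge is the shift of [h]. *)
Lemma shift_commute f g h l :
  ray f -> 0 < l -> (forall k, a g (f k) = f (k + l)) -> commute g h ->
  exists s, shift f h s.
Proof.
move=> rf l0 gf gh.
have [|i [j hij]] := axis_merge rf (ray_act h rf) l0 gf.
  by move=> k /=; rewrite tact_commute // gf.
by exists (j%:Z - i%:Z)%R, i, j; split=> //; lia.
Qed.

End TreeActions.

(** * Homomorphisms from presented groups *)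

Section PresentedUniversal.
Variables (S : choiceType) (R : word S -> word S -> Prop).
Implicit Types (u w : word S).

Lemma presented_of_wordD u w :
  presented_of_word R (u ++ w) =
  (presented_of_word R u * presented_of_word R w)%g.
Proof. by rewrite -presented_of_word_cat. Qed.

Lemma presented_of_wordN s :
  presented_of_word R [:: (s, false)] = (presented_gen R s)^-1%g.
Proof.
apply/esym/mulg1_eq; rewrite -presented_of_wordD.
by apply/presented_of_wordP; exact: (word_eqv_cancel R [::] [::] s true).
Qed.

Lemma presented_ind (P : presented R -> Prop) :
  P 1%g -> (forall s g, P g -> P (presented_gen R s * g)%g) ->
  (forall s g, P g -> P ((presented_gen R s)^-1 * g)%g) -> forall g, P g.
Proof.
move=> P1 Pg PV g; rewrite -[g]presented_of_word_repr.
elim: (repr g) => [|[s []] w IH] //.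
  by rewrite -cat1s presented_of_wordD; apply: Pg.
by rewrite -cat1s presented_of_wordD presented_of_wordN; apply: PV.
Qed.

Variables (H : groupType) (phi : S -> H).

Definition word_eval w : H :=
  foldr (fun a x => (if a.2 then phi a.1 else (phi a.1)^-1) * x)%g 1%g w.

Lemma word_eval_cat u w : word_eval (u ++ w) = (word_eval u * word_eval w)%g.
Proof.
by elim: u => [|a u IH] /=; rewrite ?mul1g // IH mulgA.
Qed.

Definition compatible := forall l r, R l r -> word_eval l = word_eval r.

Lemma word_eval_eqv u w :
  compatible -> word_eqv R u w -> word_eval u = word_eval w.
Proof.
move=> phiR.
elim=> // [? ? ? _ -> _ -> //|u' v s b|u' v l r /phiR hlr].
  rewrite !word_eval_cat /= mulg1.
  by case: b => /=; rewrite ?mulgV ?mulVg ?mul1g.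
by rewrite !word_eval_cat hlr.
Qed.

Definition presented_lift of compatible := fun x : presented R =>
  word_eval (repr x).

Variable phiR : compatible.

Lemma presented_lift_word w :
  presented_lift phiR (presented_of_word R w) = word_eval w.
Proof. exact/(word_eval_eqv phiR)/word_eqv_repr. Qed.

Lemma presented_lift_gen s : presented_lift phiR (presented_gen R s) = phi s.
Proof. by rewrite presented_lift_word /= mulg1. Qed.

Fact presented_lift_monoid_morphism :
  monoid.monoid_morphism (presented_lift phiR).
Proof.
split=> [|x y]; first by rewrite presented_lift_word.
rewrite -[x]presented_of_word_repr -[y]presented_of_word_repr.
by rewrite -presented_of_wordD !presented_lift_word word_eval_cat.
Qed.

HB.instance Definition _ := isUMagmaMorphism.Build (presented R) H
  (presented_lift phiR) presented_lift_monoid_morphism.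

End PresentedUniversal.

(* The triple (a, b, c) stands for the integer matrix
   [[1, a, c], [0, 1, b], [0, 0, 1]]. *)
Definition heis := (int * int * int)%type.
HB.instance Definition _ := Choice.on heis.

Definition heis_mul (x y : heis) : heis :=
  (x.1.1 + y.1.1, x.1.2 + y.1.2, x.2 + y.2 + x.1.1 * y.1.2)%R.
Definition heis_one : heis := (0, 0, 0)%R.
Definition heis_inv (x : heis) : heis :=
  (- x.1.1, - x.1.2, x.1.1 * x.1.2 - x.2)%R.

Fact heis_mulA : associative heis_mul.
Proof.
case=> [[a b] c] [[a' b'] c'] [[a'' b''] c''].
by rewrite /heis_mul /=; congr (_, _, _)%R; ring.
Qed.
Fact heis_mul1 : left_id heis_one heis_mul.
Proof. by case=> [[a b] c]; rewrite /heis_mul /=; congr (_, _, _)%R; ring. Qed.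
Fact heis_1mul : right_id heis_one heis_mul.
Proof. by case=> [[a b] c]; rewrite /heis_mul /=; congr (_, _, _)%R; ring. Qed.
Fact heis_Vmul : left_inverse heis_one heis_inv heis_mul.
Proof. by case=> [[a b] c]; rewrite /heis_mul /=; congr (_, _, _)%R; ring. Qed.
Fact heis_mulV : right_inverse heis_one heis_inv heis_mul.
Proof. by case=> [[a b] c]; rewrite /heis_mul /=; congr (_, _, _)%R; ring. Qed.

HB.instance Definition _ := isGroup.Build heis heis_mulA
  heis_mul1 heis_1mul heis_Vmul heis_mulV.

Lemma heisM (x y : heis) :
  (x * y)%g = (x.1.1 + y.1.1, x.1.2 + y.1.2, x.2 + y.2 + x.1.1 * y.1.2)%R.
Proof. by []. Qed.

Lemma heisX1 (x : heis) n : (x ^+ n)%g.1.1 = (n%:Z * x.1.1)%R.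
Proof.
elim: n => [|n IH]; first by rewrite expg0 mul0r.
by rewrite expgS heisM /= IH; lia.
Qed.

Lemma heis_centralX (c : int) n :
  (((0, 0, c)%R : heis) ^+ n)%g = (0, 0, n%:Z * c)%R.
Proof.
elim: n => [|n IH]; first by rewrite expg0 mul0r.
by rewrite expgS heisM IH /=; congr (_, _, _)%R; lia.
Qed.

(** * The squaring endomorphism, Heisenberg maps and weights *)

Section RaagMorphisms.
Variable Gamma : sgraph.
Implicit Types (x y : Gamma) (g : raag Gamma).

Definition rgen x : raag Gamma := presented_gen (@raag_rel Gamma) x.

Lemma raag_ind (P : raag Gamma -> Prop) :
  P 1%g -> (forall x g, P g -> P (rgen x * g)%g) ->
  (forall x g, P g -> P ((rgen x)^-1 * g)%g) -> forall g, P g.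
Proof. exact: presented_ind. Qed.

Lemma rgen_commute x y : sadj x y -> commute (rgen x) (rgen y).
Proof.
move=> xy; rewrite /commute -!presented_of_wordD; apply/presented_of_wordP.
have h : raag_rel [:: (x, true); (y, true)] [:: (y, true); (x, true)].
  by exists x, y.
exact: (word_eqv_rel [::] [::] h).
Qed.

Lemma raag_compatible (H : groupType) (phi : Gamma -> H) :
  (forall x y, sadj x y -> commute (phi x) (phi y)) ->
  compatible (@raag_rel Gamma) phi.
Proof. by move=> hphi l r [x [y [/hphi xy -> ->]]] /=; rewrite !mulg1 xy. Qed.

Definition square_gen x : raag Gamma := (rgen x * rgen x)%g.

Fact square_gen_commute x y : sadj x y -> commute (square_gen x) (square_gen y).
Proof.
move=> /rgen_commute xy; apply: commuteM; apply: commute_sym; apply: commuteM;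
  exact: commute_sym.
Qed.

(** Only the generators are squared: in general [square_endo g] is not [g * g]. *)
Definition square_endo := presented_lift (raag_compatible square_gen_commute).
HB.instance Definition _ := UMagmaMorphism.on square_endo.

Lemma square_endo_gen x : square_endo (rgen x) = square_gen x.
Proof. exact: presented_lift_gen. Qed.

Section Heis.
Variables al be : Gamma -> int.
Hypothesis hab : forall x y, sadj x y -> (al x * be y = al y * be x)%R.

Definition heis_gen x : heis := (al x, be x, 0%R).

(** The commutator of two Heisenberg elements is central, given by the determinant of their first
    two coordinates; [hab] makes it vanish on edges. *)
Fact heis_gen_commute x y : sadj x y -> commute (heis_gen x) (heis_gen y).
Proof.
by move=> /hab xy; rewrite /commute !heisM /= xy; congr (_, _, _)%R; lia.
Qed.

Definition raag_heis := presented_lift (raag_compatible heis_gen_commute).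
HB.instance Definition _ := UMagmaMorphism.on raag_heis.

Lemma raag_heis_gen x : raag_heis (rgen x) = heis_gen x.
Proof. exact: presented_lift_gen. Qed.

End Heis.

Fact weight_compat (al : Gamma -> int) x y :
  sadj x y -> (al x * (fun=> 0) y = al y * (fun=> 0) x)%R.
Proof. by rewrite !mulr0. Qed.

(** With second coordinate zero the Heisenberg map reduces to a homomorphism to the integers: the
    exponent sum in which [x] counts [al x]. *)
Definition weight (al : Gamma -> int) g : int :=
  (raag_heis (weight_compat al) g).1.1.

Section Weight.
Variable al : Gamma -> int.

Lemma weight_gen x : weight al (rgen x) = al x.
Proof. by rewrite /weight raag_heis_gen. Qed.

Lemma weight1 : weight al 1%g = 0%R.
Proof. by rewrite /weight gmulf1. Qed.

Lemma weightM g h : weight al (g * h)%g = (weight al g + weight al h)%R.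
Proof. by rewrite /weight gmulfM. Qed.

Lemma weightV g : weight al g^-1%g = (- weight al g)%R.
Proof. by rewrite /weight gmulfV. Qed.

Lemma weightX g n : weight al (g ^+ n)%g = (n%:Z * weight al g)%R.
Proof. by rewrite /weight gmulfXn heisX1. Qed.

Lemma weight_zexpg g z : weight al (zexpg g z) = (z * weight al g)%R.
Proof.
by case: z => n; rewrite /= ?NegzE ?mulNr ?weightV weightX.
Qed.

Lemma weight_square_endo g : weight al (square_endo g) = (2 * weight al g)%R.
Proof.
elim/raag_ind: g => [|x g IH|x g IH].
- by rewrite gmulf1 weight1.
- by rewrite gmulfM !weightM IH /= square_endo_gen weightM weight_gen; lia.
rewrite gmulfM !weightM IH gmulfV /= square_endo_gen.
by rewrite !weightV weightM weight_gen; lia.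
Qed.

Lemma torsion_weight g k :
  0 < k -> (square_endo g ^+ k)%g = 1%g -> weight al g = 0%R.
Proof.
move=> k0 /(congr1 (weight al)); rewrite weightX weight_square_endo weight1.
by nia.
Qed.

End Weight.

(** Take for [al] and [be] the indicators of [x] and [y]; non-adjacency makes them admissible. The
    squares go to (2, 0, 0) and (0, 2, 0), whose commutator (0, 0, 4) has infinite order. *)
Lemma commutator_not_torsion x y k :
  x != y -> ~~ sadj x y -> (square_endo [~ rgen x, rgen y] ^+ k)%g = 1%g ->
  k = 0.
Proof.
move=> xy nxy; pose al z : int := (z == x); pose be z : int := (z == y).
have hab0 u v : sadj u v -> (al u * be v = 0)%R.
  rewrite /al /be; case: eqVneq => [->|_]; last by rewrite mul0r.
  by case: eqVneq => [->|_]; rewrite ?mulr0 // (negPf nxy).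
have hab u v : sadj u v -> (al u * be v = al v * be u)%R.
  by move=> uv; rewrite !hab0 // sadj_sym.
move=> /(congr1 (raag_heis hab)); rewrite gmulf1 gmulfXn !gmulfR.
rewrite /= !square_endo_gen !gmulfM /= !raag_heis_gen.
have -> : [~ heis_gen al be x * heis_gen al be x,
             heis_gen al be y * heis_gen al be y]%g = (0, 0, 4)%R :> heis.
  rewrite /heis_gen /al /be !eqxx (negPf xy) eq_sym (negPf xy).
  by [].
by rewrite heis_centralX => -[]; lia.
Qed.

End RaagMorphisms.

(** * Automorphisms of a product of two trees *)

Lemma tadj_neq (T : tree) (x y : T) : tadj x y -> (x == y) = false.
Proof. by move=> xy; apply: contraTF xy => /eqP ->; rewrite tadj_irr. Qed.

Section ProductOfTrees.
Variables T1 T2 : tree.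
Implicit Types (v w p q r s : T1 * T2) (f g : T1 * T2 -> T1 * T2).

Definition padj v w :=
  (v.1 == w.1) && tadj v.2 w.2 || tadj v.1 w.1 && (v.2 == w.2).

Lemma tree_cellP (T : tree) (A : set T) x y :
  tree_cell A -> A x -> A y -> x = y \/ tadj x y /\ A = [set x; y]%classic.
Proof.
move=> [[z ->]|[z [t [zt ->]]]] /=; first by move=> -> ->; left.
move=> [->|->] [->|->]; [by left|by right| |by left].
by right; rewrite tadj_sym setUC.
Qed.

Lemma product_cube_edge v w :
  v != w -> product_cube [set v; w]%classic <-> padj v w.
Proof.
move=> vw; split=> [[A [B [cA cB eC]]]|].
  have [Av Bv] : (A `*` B)%classic v by rewrite -eC; left.
  have [Aw Bw] : (A `*` B)%classic w by rewrite -eC; right.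
  have [e1|[a1 _]] := tree_cellP cA Av Aw;
  have [e2|[a2 _]] := tree_cellP cB Bv Bw.
  - by case/eqP: vw; rewrite [v]surjective_pairing e1 e2 -surjective_pairing.
  - by rewrite /padj e1 eqxx a2.
  - by rewrite /padj e2 eqxx a1 orbT.
  (* If both coordinates differed, the cube would contain the corner [(v.1, w.2)], which is neither
     [v] nor [w]. *)
  have : [set v; w]%classic (v.1, w.2) by rewrite eC.
  by case=> e; [move: a2 | move: a1]; rewrite -e /= tadj_irr.
case: v w {vw} => [v1 v2] [w1 w2].
case/orP=> [/andP[/eqP /= -> a2]|/andP[/= a1 /eqP ->]].
  exists [set w1]%classic, [set v2; w2]%classic; split;
    first by left; exists w1.
    by right; exists v2, w2.
  by apply/seteqP; split=> [[x y] [[-> ->]|[-> ->]]|[x y] [/= -> [->|->]]];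
    [split=> //; left|split=> //; right|left|right].
exists [set v1; w1]%classic, [set w2]%classic; split;
  first by right; exists v1, w1.
  by left; exists w2.
by apply/seteqP; split=> [[x y] [[-> ->]|[-> ->]]|[x y] [/= [->|->] ->]];
    [split=> //; left|split=> //; right|left|right].
Qed.

Lemma padj_neq v w : padj v w -> v != w.
Proof.
by apply: contraTneq => ->; rewrite /padj !tadj_irr andbF.
Qed.

Lemma cube_automorphism_adj f v w :
  cube_automorphism f -> padj v w -> padj (f v) (f w).
Proof.
move=> [/bij_inj finj fC] vw; have nvw := padj_neq vw.
apply/product_cube_edge; first by rewrite (inj_eq finj).
by rewrite -!image_set1 -image_setU -fC; apply/product_cube_edge.
Qed.

Lemma tree_no_square (T : tree) (x y z t : T) :
  tadj x y -> tadj y z -> tadj z t -> tadj t x -> x != z -> y != t -> False.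
Proof.
move=> xy yz zt tx xz yt.
apply: (@tree_acyclic T [:: x; y; z; t]) => //.
rewrite /ucycle /= xy yz zt tx !inE !negb_or xz yt.
by rewrite (tadj_neq xy) (tadj_neq yz) (tadj_neq zt) eq_sym (tadj_neq tx).
Qed.

Definition horizontal v w := v.2 == w.2.

(** If two consecutive edges had the same direction, the other two would either close up a 4-cycle
    in a single tree or force [p = r]. *)
Lemma square_turns p q r s :
  padj p q -> padj q r -> padj r s -> padj s p -> p != r -> q != s ->
  horizontal p q = ~~ horizontal q r.
Proof.
case: p q r s => [p1 p2] [q1 q2] [r1 r2] [s1 s2].
rewrite /padj /horizontal !xpair_eqE !negb_and /=.
case/orP=> /andP[]; [move/eqP=> <- a1|move=> a1 /eqP <-];
case/orP=> /andP[];
  [move/eqP=> <- a2|move=> a2 /eqP <-|move/eqP=> <- a2|move=> a2 /eqP <-];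
rewrite ?eqxx /=.
- case/orP=> /andP[]; [move/eqP=> <- a3|move=> a3 /eqP <-];
  case/orP=> /andP[];
    [move=> _ a4|move=> a4 /eqP e|move/eqP=> e a4| move=> a4 /eqP e];
  rewrite ?eqxx /= => h1 h2.
  + by case: (tree_no_square a1 a2 a3 a4 h1 h2).
  + by rewrite tadj_irr in a4.
  + by rewrite e tadj_irr in a3.
  + by rewrite e eqxx in h1.
- by rewrite (tadj_neq a1).
- by rewrite (tadj_neq a2).
- case/orP=> /andP[]; [move/eqP=> <- a3|move=> a3 /eqP <-];
  case/orP=> /andP[];
    [move/eqP=> e a4|move=> a4 /eqP e|move=> _ a4|move=> a4 _];
  rewrite ?eqxx ?orbF /= => h1 h2.
  + by rewrite e eqxx in h1.
  + by rewrite e tadj_irr in a3.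
  + by rewrite tadj_irr in a4.
  + by case: (tree_no_square a1 a2 a3 a4 h1 h2).
Qed.

Lemma tree_const (T : tree) (A : Type) (F : T -> A) :
  (forall x y, tadj x y -> F x = F y) -> forall x y, F x = F y.
Proof.
move=> hF x y; have [p] := tree_connected x y.
elim: p x => [|z p IH] x /=; first by move=> _ ->.
by move=> /andP[xz zp] /(IH _ zp) <-; apply: hF.
Qed.

Definition splits f :=
  (forall x y y', (f (x, y)).1 = (f (x, y')).1) /\
  (forall x x' y, (f (x, y)).2 = (f (x', y)).2).

Definition swaps f :=
  (forall x x' y, (f (x, y)).1 = (f (x', y)).1) /\
  (forall x y y', (f (x, y)).2 = (f (x, y')).2).

Lemma swaps_comp f : swaps f -> splits (f \o f).
Proof.
move=> [f1 f2]; split=> [x y y'|x x' y] /=.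
  rewrite [f (x, y)]surjective_pairing [f (x, y')]surjective_pairing.
  by rewrite (f2 x y y'); apply: f1.
rewrite [f (x, y)]surjective_pairing [f (x', y)]surjective_pairing.
by rewrite (f1 x x' y); apply: f2.
Qed.

Lemma splits_comp f g : splits f -> splits g -> splits (f \o g).
Proof.
move=> [f1 f2] [g1 g2]; split=> [x y y'|x x' y] /=.
  rewrite [g (x, y)]surjective_pairing [g (x, y')]surjective_pairing.
  by rewrite (g1 x y y'); apply: f1.
rewrite [g (x, y)]surjective_pairing [g (x', y)]surjective_pairing.
by rewrite (g2 x x' y); apply: f2.
Qed.

Lemma no_edge_eq (T : tree) :
  ~ (exists e : T * T, tadj e.1 e.2) -> forall x y : T, x = y.
Proof.
by move=> ne; apply: (@tree_const T T id) => x y xy; case: ne; exists (x, y).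
Qed.

(** Squares go to squares, whose sides alternate in direction, so parallel edges have images of the
    same direction. By connectedness one bit decides for all edges. A tree without edges is a point,
    and then [f] splits trivially. *)
Lemma splits_or_swaps f :
  injective f -> (forall v w, padj v w -> padj (f v) (f w)) ->
  splits f \/ swaps f.
Proof.
move=> finj fadj.
have [[[x0 x0'] /= ex]|/no_edge_eq eq1] :=
    EM (exists e : T1 * T1, tadj e.1 e.2);
  last first.
  by left; split=> [x y y'|x x' y]; [apply: eq1 | rewrite (eq1 x x')].
have [[[y0 y0'] /= ey]|/no_edge_eq eq2] :=
    EM (exists e : T2 * T2, tadj e.1 e.2);
  last first.
  by left; split=> [x y y'|x x' y]; [rewrite (eq2 y y') | apply: eq2].
pose H x x' y := horizontal (f (x, y)) (f (x', y)).
pose V x y y' := horizontal (f (x, y)) (f (x, y')).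
have Hsym x x' y : H x x' y = H x' x y by rewrite /H /horizontal eq_sym.
have turn x x' y y' : tadj x x' -> tadj y y' ->
    H x x' y = ~~ V x' y y' /\ V x' y y' = ~~ H x' x y'.
  move=> xx' yy'.
  have p1 : padj (f (x, y)) (f (x', y)).
    by apply/fadj; rewrite /padj xx' eqxx orbT.
  have p2 : padj (f (x', y)) (f (x', y')) by apply/fadj; rewrite /padj yy' eqxx.
  have p3 : padj (f (x', y')) (f (x, y')).
    by apply/fadj; rewrite /padj /= tadj_sym xx' eqxx orbT.
  have p4 : padj (f (x, y')) (f (x, y)).
    by apply/fadj; rewrite /padj /= (tadj_sym y') yy' eqxx.
  have nxy : x != x' by apply: contraTneq xx' => ->; rewrite tadj_irr.
  split; [apply: square_turns p1 p2 p3 p4 _ _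
        |apply: square_turns p2 p3 p4 p1 _ _];
    by rewrite (inj_eq finj) xpair_eqE ?(eq_sym x') (negPf nxy).
have Hc x x' y y' : tadj x x' -> H x x' y = H x x' y'.
  move=> xx'; apply: (@tree_const T2 bool (H x x')) => {}y {}y' yy'.
  by have [-> ->] := turn _ _ _ _ xx' yy'; rewrite negbK Hsym.
have Vc x x' y y' : tadj y y' -> V x y y' = V x' y y'.
  move=> yy'; apply: (@tree_const T1 bool (fun x => V x y y')) => {}x {}x' xx'.
  have [e1 _] := turn _ _ _ _ xx' yy'.
  have [e2 _] := turn x' x y y' ltac:(by rewrite tadj_sym) yy'.
  by apply: negb_inj; rewrite -e1 -e2 Hsym.
(* [b] tells whether edges in the second direction are sent to the first one, that is, whether [f]
   swaps. *)
pose b := V x0 y0 y0'.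
have Hb x x' y : tadj x x' -> H x x' y = ~~ b.
  move=> xx'; rewrite (Hc _ _ _ y0 xx'); have [-> _] := turn _ _ _ _ xx' ey.
  by rewrite (Vc _ x0).
have Vb x y y' : tadj y y' -> V x y y' = b.
  move=> yy'; apply: negb_inj.
  rewrite (Vc _ x0') //; have [<- _] := turn _ _ _ _ ex yy'.
  by rewrite Hb.
have adj1 v w : padj v w -> ~~ horizontal v w -> v.1 = w.1.
  rewrite /padj /horizontal => + /negPf e.
  by rewrite e andbF orbF => /andP[/eqP].
have pH x x' y : tadj x x' -> padj (f (x, y)) (f (x', y)).
  by move=> xx'; apply/fadj; rewrite /padj xx' eqxx orbT.
have pV x y y' : tadj y y' -> padj (f (x, y)) (f (x, y')).
  by move=> yy'; apply/fadj; rewrite /padj yy' eqxx.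
case eb: b; [right | left]; split=> [x y1 y2|x y1 y2].
- apply: (@tree_const T1 _ (fun x => (f (x, y2)).1)) => {}x x' xx'.
  by apply: adj1; [exact: pH | rewrite -/(H _ _ _) Hb // eb].
- apply: (@tree_const T2 _ (fun y => (f (x, y)).2)) => y y' yy'.
  by apply/eqP; rewrite -[_ == _]/(V _ _ _) Vb.
- apply: (@tree_const T2 _ (fun y => (f (x, y)).1)) => y y' yy'.
  by apply: adj1; [exact: pV | rewrite -/(V _ _ _) Vb // eb].
- apply: (@tree_const T1 _ (fun x => (f (x, y2)).2)) => {}x x' xx'.
  by apply/eqP; rewrite -[_ == _]/(H _ _ _) Hb // eb.
Qed.

End ProductOfTrees.

(** * Proper actions of Artin groups *)

Lemma factor_actions (Gamma : sgraph) (T1 T2 : tree)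
    (rho : cube_action (raag Gamma) T1 T2) :
  exists (a1 : tree_action (raag Gamma) T1) (a2 : tree_action (raag Gamma) T2),
    forall g x y, rho (square_endo g) (x, y) = (a1 g x, a2 g y).
Proof.
have [x0] := tree_inhabited T1; have [y0] := tree_inhabited T2.
have sqs g : splits (rho (g * g)%g).
  have -> : rho (g * g)%g = rho g \o rho g by apply/funext => v; rewrite cactM.
  have [/bij_inj inj _] := cact_aut rho g.
  have adj v w := @cube_automorphism_adj _ _ _ v w (cact_aut rho g).
  by have [h|h] := splits_or_swaps inj adj;
    [apply: splits_comp|apply: swaps_comp].
have spl g : splits (rho (square_endo g)).
  elim/raag_ind: g => [|x g IH|x g IH].
  - have -> : rho (square_endo 1%g) = id.
      by apply/funext => v; rewrite gmulf1 cact1.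
    by [].
  - have -> : rho (square_endo (rgen x * g)%g) =
        rho (square_gen x) \o rho (square_endo g).
      by apply/funext => v; rewrite gmulfM cactM /= square_endo_gen.
    exact: splits_comp (sqs _) IH.
  have -> : rho (square_endo ((rgen x)^-1 * g)%g) =
      rho ((rgen x)^-1 * (rgen x)^-1)%g \o rho (square_endo g).
    by apply/funext => v; rewrite gmulfM cactM gmulfV /= square_endo_gen invgM.
  exact: splits_comp (sqs _) IH.
(* The base points [x0] and [y0] are arbitrary, since by [spl] each coordinate ignores the other
   one. *)
pose b1 g x := (rho (square_endo g) (x, y0)).1.
pose b2 g y := (rho (square_endo g) (x0, y)).2.
have bE g x y : rho (square_endo g) (x, y) = (b1 g x, b2 g y).
  rewrite [LHS]surjective_pairing; congr (_, _); first exact: (spl g).1.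
  exact: (spl g).2.
have b11 x : b1 1%g x = x by rewrite /b1 gmulf1 cact1.
have b21 y : b2 1%g y = y by rewrite /b2 gmulf1 cact1.
have b1M g h x : b1 (g * h)%g x = b1 g (b1 h x).
  by rewrite {1}/b1 gmulfM cactM /= !bE.
have b2M g h y : b2 (g * h)%g y = b2 g (b2 h y).
  by rewrite {1}/b2 gmulfM cactM /= !bE.
have badj g v w :=
  @cube_automorphism_adj _ _ _ v w (cact_aut rho (square_endo g)).
have b1a g x x' : tadj x x' -> tadj (b1 g x) (b1 g x').
  move=> xx'; have := badj g (x, y0) (x', y0).
  rewrite /padj xx' eqxx /= !bE orbT => /(_ isT) /=.
  by rewrite tadj_irr andbF eqxx andbT.
have b2a g y y' : tadj y y' -> tadj (b2 g y) (b2 g y').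
  move=> yy'; have := badj g (x0, y) (x0, y').
  rewrite /padj yy' eqxx /= !bE => /(_ isT) /=.
  by rewrite tadj_irr eqxx orbF.
by exists (TreeAction b11 b1M b1a), (TreeAction b21 b2M b2a).
Qed.

(** All powers of [g] lie in the finite stabiliser of [v], so two of them coincide. *)
Lemma proper_stabiliser_torsion (G : groupType) (T1 T2 : tree)
    (rho : cube_action G T1 T2) v g :
  proper_action rho -> rho g v = v -> exists2 k, 0 < k & (g ^+ k = 1)%g.
Proof.
move=> /(_ v) fin gv; apply: contrapT => notor.
have inj : injective (fun k => g ^+ k)%g.
  have lt i j : i < j -> (g ^+ i)%g <> (g ^+ j)%g.
    move=> ij e; apply: notor; exists (j - i); first by lia.
    by rewrite expgnFr ?(ltnW ij) // e mulgV.
  by move=> i j e; case: (ltngtP i j) => // /lt []; rewrite e.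
have fixX k : rho (g ^+ k)%g v = v.
  by elim: k => [|k IH]; rewrite ?expg0 ?cact1 // expgS cactM IH.
apply: infinite_nat; apply: sub_finite_set (finite_preimage _ fin).
  by move=> k _; apply: fixX.
by move=> i j _ _; apply: inj.
Qed.

(** The trace that properness leaves on the two factor actions; it is symmetric in the two trees. *)
Definition jointly_elliptic_torsion (Gamma : sgraph) (T1 T2 : tree)
    (a1 : tree_action (raag Gamma) T1) (a2 : tree_action (raag Gamma) T2) :=
  forall g, elliptic a1 g -> elliptic a2 g ->
    exists2 k, 0 < k & (square_endo g ^+ k = 1)%g.

(** * Axes of adjacent generators *)

Section Obstruction.
Variables (Gamma : sgraph) (T1 T2 : tree).
Variables (a1 : tree_action (raag Gamma) T1) (a2 : tree_action (raag Gamma) T2).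
Hypothesis tor : jointly_elliptic_torsion a1 a2.

(** The weight of [dirac x] is the exponent sum of [x]. *)
Let dirac (x y : Gamma) : int := (y == x).

Lemma elliptic_weight al g :
  elliptic a1 g -> elliptic a2 g -> weight al g = 0%R.
Proof. by move=> e1 e2; have [k k0 /(torsion_weight al k0)] := tor e1 e2. Qed.

Lemma edge_has_axis x y :
  sadj x y -> has_axis a2 (rgen x) \/ has_axis a2 (rgen y).
Proof.
move=> xy; apply: contrapT => /not_orP [nx ny].
have nxy : x != y by apply: contraTneq xy => ->; rewrite sadj_irr.
have [ex|//] := elliptic_or_axis a2 (rgen x).
have [ey|//] := elliptic_or_axis a2 (rgen y).
have [v [xv yv]] := elliptic_common_fixpoint (square_gen_commute xy) ex ey.
(* If the square of [x] were elliptic in the first tree too, its exponent sum 2 would have to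
   vanish. *)
have [e1x|[f [l [rf l0 xf]]]] := elliptic_or_axis a1 (rgen x).
  have := elliptic_weight (dirac x) e1x ex.
  by rewrite weightM weight_gen /dirac eqxx.
have [s yf] := shift_commute rf l0 xf (rgen_commute xy).
have {}xf := axis_shift xf.
(* The squares of [x] and [y] shift [f] by [2 l] and [2 s], so these exponents cancel. The exponent
   of [y] is nonzero because [l] is positive, whereas [s] may be zero. *)
pose c := (zexpg (rgen x * rgen x) (- s)%R * zexpg (rgen y * rgen y) l%:Z)%g.
have e2 : elliptic a2 c by exists v; rewrite tactM !fix_zexpg.
have e1 : elliptic a1 c.
  apply: (@shift0_elliptic _ _ _ f).
  have -> : 0%R = (- s * (l%:Z + l%:Z) + l%:Z * (s + s))%R by ring.
  by apply/shiftM; apply/shift_zexpg/shiftM.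
have := elliptic_weight (dirac y) e1 e2.
rewrite weightM !weight_zexpg !weightM !weight_gen /dirac eqxx (negPf nxy).
lia.
Qed.

Lemma common_axis_neighbours u x y :
  has_axis a1 (rgen u) -> has_axis a2 (rgen u) -> sadj u x -> sadj u y -> x = y.
Proof.
move=> [f [l [rf l0 uf]]] [f' [l' [rf' l0' uf']]] ux uy.
apply/eqP/negPn/negP => nxy.
have [s xf] := shift_commute rf l0 uf (rgen_commute ux).
have [t yf] := shift_commute rf l0 uf (rgen_commute uy).
have [s' xf'] := shift_commute rf' l0' uf' (rgen_commute ux).
have [t' yf'] := shift_commute rf' l0' uf' (rgen_commute uy).
have {}uf := axis_shift uf; have {}uf' := axis_shift uf'.
have [xy|nadj] := boolP (sadj x y); last first.
  have ell T (a : tree_action (raag Gamma) T) h b d :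
      shift a h (rgen x) b -> shift a h (rgen y) d ->
      elliptic a [~ rgen x, rgen y]%g.
    move=> hx hy; apply: (@shift0_elliptic _ _ _ h).
    have -> : 0%R = (- b + (- d + (b + d)))%R by ring.
    by do !apply: shiftM => //; apply: shiftV.
  have [k k0 /(commutator_not_torsion nxy nadj)] :=
    tor (ell _ _ _ _ _ xf yf) (ell _ _ _ _ _ xf' yf').
  by lia.
have [p [q [r [nz e e']]]] : exists p q r : int,
    [/\ ~ [/\ p = 0, q = 0 & r = 0], p * l%:Z + q * s + r * t = 0 &
        p * l'%:Z + q * s' + r * t' = 0]%R.
  (* The coefficients are the cross product of [(l, s, t)] and [(l', s', t')]. If it vanishes,
     [(- s, l, 0)] serves instead, nonzero because [l] is positive. *)
  have [|nz] := EM [/\ s * t' - t * s' = 0, t * l'%:Z - l%:Z * t' = 0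
                   & l%:Z * s' - s * l'%:Z = 0]%R.
    move=> [_ _ h]; exists (- s)%R, l%:Z, 0%R.
    split; [by case; lia | by ring |].
    by rewrite -[RHS]h; ring.
  exists (s * t' - t * s')%R, (t * l'%:Z - l%:Z * t')%R,
    (l%:Z * s' - s * l'%:Z)%R.
  by split=> //; ring.
pose c := (zexpg (rgen u) p * zexpg (rgen x) q * zexpg (rgen y) r)%g.
have e1 : elliptic a1 c.
  apply: (@shift0_elliptic _ _ _ f); rewrite -e.
  by do !apply: shiftM; apply: shift_zexpg.
have e2 : elliptic a2 c.
  apply: (@shift0_elliptic _ _ _ f'); rewrite -e'.
  by do !apply: shiftM; apply: shift_zexpg.
have w al : (p * al u + q * al x + r * al y = 0)%R.
  by have := elliptic_weight al e1 e2;
    rewrite !weightM !weight_zexpg !weight_gen.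
have neq (z z' : Gamma) : sadj z z' -> (z == z') = false /\ (z' == z) = false.
  move=> zz'; split; apply/negbTE; apply: contraTneq zz' => ->;
    by rewrite sadj_irr.
have [ux1 ux2] := neq _ _ ux; have [uy1 uy2] := neq _ _ uy.
have [xy1 xy2] := neq _ _ xy.
(* The exponent sums of [u], [x] and [y] in [c] isolate [p], [q] and [r]. *)
apply: nz; split; [move: (w (dirac u))|move: (w (dirac x))|move: (w (dirac y))];
  rewrite /dirac !eqxx ?ux1 ?ux2 ?uy1 ?uy2 ?xy1 ?xy2; lia.
Qed.

End Obstruction.

(** * Odd cycles and the conclusion *)

Lemma iter_ordS n k : val (iter k (@ordS n.+1) ord0) = k %% n.+1.
Proof. by elim: k => [|k IH]; rewrite ?mod0n //= IH -addn1 modnDml addn1. Qed.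

(** If [P] and [Q] were disjoint, [P] could not hold at both ends of an edge, where [Q] would then
    fail twice. So [P] would alternate around the cycle, against odd length. *)
Lemma odd_cycle_edge_covers n (P Q : 'I_n -> Prop) :
  odd n -> (forall i, P i \/ P (ordS i)) -> (forall i, Q i \/ Q (ordS i)) ->
  exists i, P i /\ Q i.
Proof.
case: n P Q => // n P Q oddn hP hQ; apply: contrapT => nPQ.
have cS i : `[< P (ordS i) >] = ~~ `[< P i >].
  have [Pi|nPi] := asboolP (P i); last first.
    by apply/asboolP; case: (hP i).
  apply/asboolPn => PSi; case: (hQ i) => Qi; apply: nPQ; first by exists i.
  by exists (ordS i).
have it k : `[< P (iter k (@ordS n.+1) ord0) >] = odd k (+) `[< P ord0 >].
  by elim: k => [|k IH] //=; rewrite cS IH addNb.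
have := it n.+1; have -> : iter n.+1 (@ordS n.+1) ord0 = ord0.
  by apply: val_inj; rewrite iter_ordS modnn.
by rewrite oddn; case: `[< _ >].
Qed.

Lemma ordS2_neq n (i : 'I_n) : 2 < n -> ordS (ordS i) != i.
Proof.
move=> n2; apply/eqP => /(congr1 val) /=; have := ltn_ord i.
have [lt|le] := ltnP i.+1 n.
  rewrite (modn_small lt); have [lt2|le2] := ltnP i.+2 n.
    by rewrite modn_small //; lia.
  by have -> : i.+2 = n by [lia]; rewrite modnn; lia.
move=> lt; have -> : i.+1 = n by lia.
by rewrite modnn modn_small; lia.
Qed.

Theorem proposition5p5 (Gamma : sgraph) (n : nat)
    (hcycle : is_cycle_graph Gamma n) (hodd : odd n)
    (T1 T2 : tree) (rho : cube_action (raag Gamma) T1 T2) :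
  ~ proper_action rho.
Proof.
move=> prop; have [n2 [f /bij_inj finj fadj]] := hcycle.
have [a1 [a2 rhoE]] := factor_actions rho.
have tor : jointly_elliptic_torsion a1 a2.
  move=> g [x gx] [y gy]; apply: (proper_stabiliser_torsion (v := (x, y)) prop).
  by rewrite rhoE gx gy.
(* [edge_has_axis] yields axes in the second tree of its pair; exchanging the trees gives those in
   the first. *)
have tor' : jointly_elliptic_torsion a2 a1 by move=> g e2 e1; apply: tor.
have adjS i : sadj (f i) (f (ordS i)) by rewrite fadj eqxx.
have [i [i1 i2]] := odd_cycle_edge_covers hodd
  (fun i => edge_has_axis tor' (adjS i)) (fun i => edge_has_axis tor (adjS i)).
have adjP : sadj (f i) (f (ord_pred i)) by rewrite sadj_sym -{2}[i]ord_predK.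
have := common_axis_neighbours tor i1 i2 (adjS i) adjP.
(* The two neighbours of [f i] would coincide, so two steps around the cycle would return to [i]. *)
by move=> /finj e; have := ordS2_neq i n2; rewrite e ord_predK eqxx.
Qed.
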